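(* Let $A\in\mathbb{R}^{m\times n}$, let $x^\dagger$ (with values in $\mathbb{R}^n$) and $\varepsilon$ (with values in $\mathbb{R}^m$) be uncorrelated, square-integrable random variables with $\mathbb{E}(x^\dagger)=\mu_{x^\dagger}$, $\operatorname{Cov}(x^\dagger)=\Sigma_{x^\dagger}$, $\mathbb{E}(\varepsilon)=0$ and $\operatorname{Cov}(\varepsilon)=\Sigma_\varepsilon$. Assume that the matrix $B:=A^T(A\Sigma_{x^\dagger}A^T+\Sigma_\varepsilon)A$ is invertible. Then the bilevel learning problem $$\min_{M,x_0}\ \mathbb{E}_{x^\dagger,\varepsilon}\,\|\hat x-x^\dagger\|^2\quad\text{s.t.}\quad \hat x=\operatorname*{argmin}_{x}\ \|Ax-(Ax^\dagger+\varepsilon)\|^2+\langle M(x-x_0),x-x_0\rangle$$ has the following solution: Let $N\in\mathbb{R}^{n\times n}$ be the unique symmetric solution of the Lyapunov equation $$A^TA\Sigma_{x^\dagger}+\Sigma_{x^\dagger}A^TA=NB+BN.$$ If $N$ is invertible, then the optimal $M$ and $x_0$ are given by $$x_0\in\mu_{x^\dagger}+\ker(M)\qquad\text{and}\qquad M=N^{-1}-A^TA.$$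
   Context: All random variables are defined on a fixed probability space. $\operatorname{Cov}(x)=\mathbb{E}\big((x-\mathbb{E}x)(x-\mathbb{E}x)^T\big)$. Uncorrelated means that the cross-covariance $\mathbb{E}\big((x^\dagger-\mathbb{E}x^\dagger)(\varepsilon-\mathbb{E}\varepsilon)^T\big)$ is zero. $\|\cdot\|$ and $\langle\cdot,\cdot\rangle$ are the Euclidean norm and inner product. The learned parameters are $x_0\in\mathbb{R}^n$ and a symmetric matrix $M\in\mathbb{R}^{n\times n}$, which is not assumed to be positive semidefinite.
   Formalization: With argmin taken literally the claim fails if N is invertible but not positive definite (no minimizer exists); there the formulas are proved exactly when N is positive definite, and for every invertible N when x̂ is the unique critical point of the lower-level functional. *)

(* Defs.v *)
From HB Require Import structures.
From mathcomp Require Import all_boot all_order all_algebra.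
From mathcomp Require Import all_classical all_reals all_analysis.

Set Implicit Arguments.
Unset Strict Implicit.
Unset Printing Implicit Defensive.

Import Order.TTheory GRing.Theory Num.Theory.
Import numFieldNormedType.Exports.

Local Open Scope classical_set_scope.
Local Open Scope ring_scope.

(* The norm that MathComp-Analysis puts on matrices is the maximum norm, so the
   Euclidean structure of 'cV[R]_k is defined here. *)
Definition inner (R : realType) (k : nat) (u v : 'cV[R]_k) : R :=
  \sum_(i < k) u i 0 * v i 0.

Definition norm2 (R : realType) (k : nat) (u : 'cV[R]_k) : R :=
  Num.sqrt (inner u u).

Definition posdefmx (R : realType) (k : nat) (S : 'M[R]_k) : Prop :=
  forall v : 'cV[R]_k, v != 0 -> 0 < inner (S *m v) v.

Section RandomVectors.
Context (d : measure_display) (T : measurableType d) (R : realType).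
Variable P : probability T R.

(* Componentwise measurability is Borel measurability into R^k. *)
Definition random_vector (k : nat) (X : T -> 'cV[R]_k) : Prop :=
  forall i : 'I_k, measurable_fun setT (fun w => X w i 0).

Definition mean_sq (k : nat) (X : T -> 'cV[R]_k) : \bar R :=
  'E_P[fun w => (norm2 (X w) ^+ 2)%R].

Definition square_integrable (k : nat) (X : T -> 'cV[R]_k) : Prop :=
  random_vector X /\ (mean_sq X < +oo)%E.

(* Entrywise expectation; [fine] turns a finite extended real into a real, and
   all the entries it is applied to below are finite under square
   integrability. *)
Definition Emx (k l : nat) (X : T -> 'M[R]_(k, l)) : 'M[R]_(k, l) :=
  \matrix_(i, j) fine 'E_P[fun w => X w i j].

Definition cross_cov (k l : nat) (X : T -> 'cV[R]_k) (Y : T -> 'cV[R]_l) :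
    'M[R]_(k, l) :=
  Emx (fun w => (X w - Emx X) *m (Y w - Emx Y)^T).

Definition cov (k : nat) (X : T -> 'cV[R]_k) : 'M[R]_k := cross_cov X X.

Definition uncorrelated (k l : nat) (X : T -> 'cV[R]_k) (Y : T -> 'cV[R]_l) :
    Prop :=
  cross_cov X Y = 0.

End RandomVectors.

Section Bilevel.
Context (R : realType) (m n : nat).

Definition argmin (f : 'cV[R]_n -> R) : set 'cV[R]_n :=
  [set x | forall z, f x <= f z].

Definition critical (f : 'cV[R]_n -> R) : set 'cV[R]_n :=
  [set x | forall v, is_derive x v f 0].

Variable A : 'M[R]_(m, n).

Definition lower_objective (M : 'M[R]_n) (x0 : 'cV[R]_n) (y : 'cV[R]_m)
    (x : 'cV[R]_n) : R :=
  norm2 (A *m x - y) ^+ 2 + inner (M *m (x - x0)) (x - x0).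

Context (d : measure_display) (T : measurableType d).
Variables (P : probability T R) (xdag : T -> 'cV[R]_n) (eps : T -> 'cV[R]_m).

(* The lower-level problem has a unique solution for every realization of the
   data, and xhat is the resulting reconstruction. [sol f] is the set of points
   that count as lower-level solutions: [argmin f], or [critical f] when the
   lower-level problem is replaced by its first-order optimality condition.
   Since M may be indefinite the two differ: with G := A^T A, the argmin is a
   singleton iff G + M is positive definite, the critical set is a singleton iff
   G + M is invertible. *)
Definition reconstruction (sol : ('cV[R]_n -> R) -> set 'cV[R]_n)
    (M : 'M[R]_n) (x0 : 'cV[R]_n) (xhat : T -> 'cV[R]_n) : Prop :=
  forall w, sol (lower_objective M x0 (A *m xdag w + eps w)) = [set xhat w].

Definition upper_objective (xhat : T -> 'cV[R]_n) : \bar R :=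
  mean_sq P (fun w => (xhat w - xdag w)%R).

Definition bilevel_solution (sol : ('cV[R]_n -> R) -> set 'cV[R]_n)
    (M : 'M[R]_n) (x0 : 'cV[R]_n) : Prop :=
  M^T = M /\
  exists2 xhat, reconstruction sol M x0 xhat &
    forall (M' : 'M[R]_n) (x0' : 'cV[R]_n) (xhat' : T -> 'cV[R]_n),
      M'^T = M' -> reconstruction sol M' x0' xhat' ->
      (upper_objective xhat <= upper_objective xhat')%E.

End Bilevel.

Definition lyapunov (R : realType) (m n : nat) (A : 'M[R]_(m, n))
    (Sx B N : 'M[R]_n) : Prop :=
  A^T *m A *m Sx + Sx *m A^T *m A = N *m B + B *m N.

(* Main.v *)
Require Import Defs.
From HB Require Import structures.
From mathcomp Require Import all_boot all_order all_algebra.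
From mathcomp Require Import all_classical all_reals all_analysis.
From mathcomp Require Import measurable_realfun ring lra.
Import Order.TTheory GRing.Theory Num.Theory.
Import numFieldNormedType.Exports.
Local Open Scope classical_set_scope.
Local Open Scope ring_scope.

Set Implicit Arguments.
Unset Strict Implicit.
Unset Printing Implicit Defensive.

(** Write G = A^T A, K = G + M and, when K is invertible, W = K^-1.

    For symmetric M the lower-level objective is quadratic with Hessian 2 K, so
    its critical set is a singleton iff K is invertible and its set of
    minimizers is a singleton iff K is positive definite; in both cases the
    solution is xhat = x0 + W A^T (y - A x0) ([critical_singleton], [argmin_singleton]).

    Substituting y = A xdag + eps, the error is affine in the centered data:
      xhat - xdag = (W G - 1) (xdag - mu) + W A^T eps + W M (x0 - mu)
    ([recon_error]).  The three terms are mutually uncorrelated, so the risk is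
    a sum of three traces, and the Lyapunov equation is exactly what completes
    the square in W ([tr_completion_square]):
      risk = tr Sx - tr (N B N)
             + tr ((W - N)^T B (W - N)) + |W M (x0 - mu)|^2
    ([upper_objective_recon]).  As B is a sum of congruence transforms of
    covariances it is positive semidefinite, hence positive definite once it is
    invertible.  This makes the Lyapunov operator injective, thus bijective, on
    matrices, and makes the last two terms of the risk vanish only at W = N and
    M (x0 - mu) = 0.

    If N^-1 is an admissible K, the minimum is attained exactly there.  If only
    positive definite K are admissible and N is not positive definite, there is
    no minimizer: positive definite matrices form an open set, so from any
    admissible W one can move slightly towards N along the segment, which
    strictly decreases the risk.  [bilevel_solution_admissible] treats both
    lower-level problems at once; it only uses that such a move towards N is
    always possible. *)

(** * Euclidean inner product and positive definite matrices *)

Lemma innerE (R : realType) k (u v : 'cV[R]_k) : inner u v = \tr (u^T *m v).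
Proof.
rewrite /mxtrace big_ord1 mxE /inner; apply: eq_bigr => i _.
by rewrite mxE.
Qed.

Lemma innerC (R : realType) k (u v : 'cV[R]_k) : inner u v = inner v u.
Proof. by apply: eq_bigr => i _; rewrite mulrC. Qed.

Lemma innerDl (R : realType) k (u v w : 'cV[R]_k) :
  inner (u + v) w = inner u w + inner v w.
Proof. by rewrite !innerE linearD mulmxDl linearD. Qed.

Lemma innerDr (R : realType) k (u v w : 'cV[R]_k) :
  inner w (u + v) = inner w u + inner w v.
Proof. by rewrite innerC innerDl !(innerC w). Qed.

Lemma innerZl (R : realType) k a (u w : 'cV[R]_k) :
  inner (a *: u) w = a * inner u w.
Proof. by rewrite !innerE linearZ /= -scalemxAl linearZ. Qed.

Lemma innerZr (R : realType) k a (u w : 'cV[R]_k) :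
  inner w (a *: u) = a * inner w u.
Proof. by rewrite innerC innerZl innerC. Qed.

Lemma inner0l (R : realType) k (w : 'cV[R]_k) : inner 0 w = 0.
Proof. by rewrite innerE trmx0 mul0mx mxtrace0. Qed.

Lemma inner_mull (R : realType) k l (C : 'M[R]_(k, l)) u v :
  inner (C *m u) v = inner u (C^T *m v).
Proof. by rewrite !innerE trmx_mul mulmxA. Qed.

Lemma inner_ge0 (R : realType) k (u : 'cV[R]_k) : 0 <= inner u u.
Proof. by apply: sumr_ge0 => i _; rewrite -expr2 sqr_ge0. Qed.

Lemma inner_eq0 (R : realType) k (u : 'cV[R]_k) : (inner u u == 0) = (u == 0).
Proof.
apply/eqP/eqP => [u0|->]; last by rewrite /inner big1 // => i _; rewrite mxE mul0r.
apply/colP => i; rewrite mxE; apply/eqP; rewrite -[_ == 0]orbb -mulf_eq0.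
move/eqP: u0; rewrite psumr_eq0 => [/allP /(_ i)|j _]; last first.
  by rewrite -expr2 sqr_ge0.
by rewrite mem_index_enum; exact.
Qed.

Lemma inner_gt0 (R : realType) k (u : 'cV[R]_k) : (0 < inner u u) = (u != 0).
Proof. by rewrite lt_def inner_eq0 inner_ge0 andbT. Qed.

Lemma norm2_sq (R : realType) k (u : 'cV[R]_k) : norm2 u ^+ 2 = inner u u.
Proof. by rewrite sqr_sqrtr // inner_ge0. Qed.

Lemma unitmx_ker0 (R : realType) n (K : 'M[R]_n) :
  (forall v : 'cV[R]_n, K *m v = 0 -> v = 0) -> K \in unitmx.
Proof.
move=> ker0; rewrite -unitmx_tr -row_free_unit -kermx_eq0.
apply/rowV0P => u /sub_kermxP uK; apply: trmx_inj; rewrite trmx0; apply: ker0.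
by rewrite -[K]trmxK -trmx_mul uK trmx0.
Qed.

Lemma posdef_unit (R : realType) n (K : 'M[R]_n) : posdefmx K -> K \in unitmx.
Proof.
move=> pK; apply: unitmx_ker0 => v Kv; apply/eqP/negPn/negP => v0.
by have := pK v v0; rewrite Kv inner0l ltxx.
Qed.

Lemma posdef_inv (R : realType) n (N : 'M[R]_n) :
  N^T = N -> posdefmx N -> posdefmx (invmx N).
Proof.
move=> Nt pN v v0; have uN := posdef_unit pN.
have -> : inner (invmx N *m v) v = inner (N *m (invmx N *m v)) (invmx N *m v).
  by rewrite inner_mull Nt mulmxA mulmxV // mul1mx innerC [RHS]innerC innerC.
apply: pN; apply: contra_neq v0 => Nv.
by rewrite -[v]mul1mx -(mulmxV uN) -mulmxA Nv mulmx0.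
Qed.

(** First-order optimality in one dimension: near 0 the linear term of a
    quadratic dominates, so it must vanish when 0 is a minimizer. *)
Lemma linear_term0 (R : realType) (b q : R) :
  (forall t, 0 <= 2 * t * b + t ^+ 2 * q) -> b = 0.
Proof.
move=> h; apply/eqP/negPn/negP => b0; have b2 : 0 < b ^+ 2 by rewrite exprn_even_gt0.
have q0 : 0 <= q.
  by have := h 1; have := h (-1); lra.
(* the minimizer -b/q, shifted to avoid dividing by 0 when q = 0 *)
have := h (- b / (q + 1)).
have -> : 2 * (- b / (q + 1)) * b + (- b / (q + 1)) ^+ 2 * q =
  - (b ^+ 2 * (q + 2) / (q + 1) ^+ 2) by field; lra.
rewrite oppr_ge0 leNgt divr_gt0 //; first by rewrite mulr_gt0 //; lra.
by rewrite exprn_gt0 //; lra.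
Qed.

Definition psdmx (R : realType) (k : nat) (S : 'M[R]_k) : Prop :=
  forall v : 'cV[R]_k, 0 <= inner (S *m v) v.

Lemma posdef_psd (R : realType) n (W : 'M[R]_n) : posdefmx W -> psdmx W.
Proof.
move=> pW v; have [->|/pW/ltW //] := eqVneq v 0.
by rewrite mulmx0 inner0l.
Qed.

Lemma inner_quadD (R : realType) n (S : 'M[R]_n) (u v : 'cV[R]_n) t :
  S^T = S -> inner (S *m (u + t *: v)) (u + t *: v) =
  inner (S *m u) u + 2 * t * inner (S *m u) v + t ^+ 2 * inner (S *m v) v.
Proof.
move=> St; rewrite mulmxDr -scalemxAr !innerDl !innerDr !innerZl !innerZr.
by rewrite (inner_mull S v u) St (innerC v); ring.
Qed.

(** A vector on which a semidefinite form vanishes minimizes that form, so the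
    gradient 2 S v is zero there. *)
Lemma psd_unit_posdef (R : realType) n (S : 'M[R]_n) :
  S^T = S -> psdmx S -> S \in unitmx -> posdefmx S.
Proof.
move=> St pS uS v v0; rewrite lt_def pS andbT; apply: contra_neq v0 => Sv.
suff: inner (S *m v) (S *m v) = 0.
  move/eqP; rewrite inner_eq0 => /eqP Sv0.
  by rewrite -[v]mul1mx -(mulVmx uS) -mulmxA Sv0 mulmx0.
apply: (@linear_term0 _ _ (inner (S *m (S *m v)) (S *m v))) => t.
by have := pS (v + t *: (S *m v)); rewrite inner_quadD // Sv add0r.
Qed.

Lemma quad_bound (R : realType) n (S : 'M[R]_n) :
  exists2 C : R, 0 < C & forall v, `|inner (S *m v) v| <= C * inner v v.
Proof.
exists (1 + \sum_i \sum_j `|S i j|) => [|v].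
  by apply: ltr_pwDl => //; apply: sumr_ge0 => i _; apply: sumr_ge0.
have sq i : v i 0 ^+ 2 <= inner v v.
  rewrite /inner (bigD1 i) //= -expr2 lerDl.
  by apply: sumr_ge0 => j _; rewrite -expr2 sqr_ge0.
rewrite mulrDl mul1r ler_wpDl ?inner_ge0 // mulr_suml.
apply: le_trans (ler_norm_sum _ _ _) _; apply: ler_sum => i _.
rewrite mxE !mulr_suml; apply: le_trans (ler_norm_sum _ _ _) _.
apply: ler_sum => j _; rewrite -mulrA normrM ler_wpM2l //.
rewrite ler_norml; have := sq i; have := sq j.
have := sqr_ge0 (v j 0 + v i 0); have := sqr_ge0 (v j 0 - v i 0).
move=> *; apply/andP; split; lra.
Qed.

(** A compactness-free lower bound: evaluating the form of W at
    v - s W^-1 v gives v^T W v >= 2 s |v|^2 - s^2 v^T W^-1 v, and s = 1/C works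
    when C bounds the form of W^-1. *)
Lemma posdef_coercive (R : realType) n (W : 'M[R]_n) :
  W^T = W -> posdefmx W ->
  exists2 c : R, 0 < c & forall v, c * inner v v <= inner (W *m v) v.
Proof.
move=> Wt pW; have uW := posdef_unit pW.
have psdW := posdef_psd pW.
have [C C0 bW] := quad_bound (invmx W).
exists C^-1 => [|v]; first by rewrite invr_gt0.
have := psdW (v + (- C^-1) *: (invmx W *m v)); rewrite inner_quadD //.
rewrite mulmxA mulmxV // mul1mx (inner_mull W v (_ *m v)) Wt mulmxA mulmxV // mul1mx.
have := le_trans (ler_norm _) (bW v).
rewrite (innerC v (invmx W *m v)) => bv.
have : (- C^-1) ^+ 2 * inner (invmx W *m v) v <= C^-1 * inner v v.
  rewrite sqrrN expr2 -mulrA ler_pM2l ?invr_gt0 //.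
  by rewrite mulrC ler_pdivrMr // mulrC.
lra.
Qed.

(** Openness of the positive definite cone, in the only form used: one can
    leave W in any direction for a positive time. *)
Lemma posdef_perturb (R : realType) n (W D : 'M[R]_n) :
  W^T = W -> posdefmx W ->
  exists t : R, [/\ 0 < t, t <= 1 & posdefmx (W + t *: D)].
Proof.
move=> Wt /(posdef_coercive Wt) [c c0 cW]; have [C C0 bD] := quad_bound D.
have e0 : 0 < c / (2 * C) by rewrite divr_gt0 // mulr_gt0.
exists (Num.min 1 (c / (2 * C))); set t := Num.min _ _.
have t0 : 0 < t by rewrite lt_min ltr01.
split => // [|v v0]; first by rewrite ge_min lexx.
have tC : t * C <= c / 2.
  have : t <= c / (2 * C) by rewrite ge_min lexx orbT.
  by rewrite ler_pdivlMr ?mulr_gt0 //; lra.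
rewrite mulmxDl -scalemxAl innerDl innerZl.
have := cW v; have := bD v; rewrite ler_norml => /andP[bv _].
have v2 : 0 < inner v v by rewrite inner_gt0.
have : t * - (C * inner v v) <= t * inner (D *m v) v by rewrite ler_pM2l.
have : t * C * inner v v <= c / 2 * inner v v by rewrite ler_pM2r.
have : 0 < c * inner v v by rewrite mulr_gt0.
lra.
Qed.

Lemma tr_quad (R : realType) n k (S : 'M[R]_n) (D : 'M[R]_(n, k)) :
  \tr (D^T *m S *m D) = \sum_j inner (S *m col j D) (col j D).
Proof.
apply: eq_bigr => j _; rewrite innerC innerE /mxtrace big_ord1.
rewrite -mulmxA !mxE; apply: eq_bigr => i _; rewrite !mxE; congr (_ * _).
by apply: eq_bigr => l _; rewrite !mxE.
Qed.

Lemma tr_quad_ge0 (R : realType) n k (S : 'M[R]_n) (D : 'M[R]_(n, k)) :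
  psdmx S -> 0 <= \tr (D^T *m S *m D).
Proof. by move=> pS; rewrite tr_quad; apply: sumr_ge0 => j _; exact: pS. Qed.

Lemma tr_quad_eq0 (R : realType) n k (S : 'M[R]_n) (D : 'M[R]_(n, k)) :
  posdefmx S -> \tr (D^T *m S *m D) = 0 -> D = 0.
Proof.
move=> pS /eqP; rewrite tr_quad psumr_eq0 => [/allP D0|j _]; last exact: posdef_psd.
apply/matrixP => i j; rewrite mxE.
suff /colP /(_ i) : col j D = 0 by rewrite !mxE.
have := D0 j; rewrite mem_index_enum => /(_ isT) /= ; apply: contraTeq => Dj.
by rewrite gt_eqF // pS.
Qed.

(** * The Lyapunov equation *)

(** Pairing the equation with D gives
    tr (D B D^T) + tr (D^T B D) = 0, a sum of two nonnegative terms; the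
    second one vanishes only at D = 0. *)
Lemma lyapunov_inj (R : realType) n (B D : 'M[R]_n) :
  posdefmx B -> D *m B + B *m D = 0 -> D = 0.
Proof.
move=> pB /(congr1 (fun X => \tr (D^T *m X))).
rewrite mulmx0 mulmxDr !mxtraceD mxtrace0 mxtrace_mulC -!mulmxA => h.
have h1 := tr_quad_ge0 D (posdef_psd pB).
have := tr_quad_ge0 D^T (posdef_psd pB); rewrite trmxK -mulmxA => h2.
apply: (tr_quad_eq0 pB); move: h1; rewrite -mulmxA => h1; lra.
Qed.

(** An injective endomorphism of the finite-dimensional space of matrices is
    onto. *)
Lemma lyapunov_solve (R : realType) n (B C : 'M[R]_n) :
  posdefmx B -> exists N, C = N *m B + B *m N.
Proof.
move=> pB; pose L := lin_mx (mulmxr B) + lin_mx (mulmx B).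
have LE N : mxvec N *m L = mxvec (N *m B + B *m N).
  by rewrite mulmxDr !mul_vec_lin -linearD.
have uL : L \in unitmx.
  rewrite -row_free_unit -kermx_eq0; apply/rowV0P => u /sub_kermxP.
  rewrite -[u]vec_mxK LE => /(canRL mxvecK).
  by rewrite linear0 => /(lyapunov_inj pB) ->; rewrite linear0.
exists (vec_mx (mxvec C *m invmx L)); apply: (can_inj mxvecK).
by rewrite -LE vec_mxK -mulmxA mulVmx // mulmx1.
Qed.

(** The solution is symmetric because its transpose solves the same
    equation. *)
Lemma lyapunov_exists_unique (R : realType) m n (A : 'M[R]_(m, n)) (Sx B : 'M[R]_n) :
  Sx^T = Sx -> B^T = B -> posdefmx B ->
  exists! N : 'M[R]_n, N^T = N /\ lyapunov A Sx B N.
Proof.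
move=> Sxt Bt pB; rewrite /lyapunov; set C := _ + _.
have Ct : C^T = C by rewrite /C linearD /= !trmx_mul trmxK Sxt addrC !mulmxA.
have uniqN N N' : C = N *m B + B *m N -> C = N' *m B + B *m N' -> N = N'.
  move=> e e'; apply/eqP; rewrite -subr_eq0; apply/eqP/(lyapunov_inj pB).
  by rewrite mulmxBl mulmxBr addrACA -opprD -e -e' subrr.
have [N eN] := lyapunov_solve C pB; exists N; split => [|N' [_ eN']]; last first.
  exact: uniqN eN'.
split=> //; apply: uniqN (eN).
by rewrite -Ct eN linearD /= !trmx_mul Bt addrC.
Qed.

(** * The lower-level problem *)

(** Half the gradient of the lower-level objective at x, for symmetric M. *)
Definition lower_grad (R : realType) m n (A : 'M[R]_(m, n)) (M : 'M[R]_n)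
    (x0 : 'cV[R]_n) (y : 'cV[R]_m) (x : 'cV[R]_n) : 'cV[R]_n :=
  (A^T *m A + M) *m x - (A^T *m y + M *m x0).

(** Exact second-order expansion: both the derivative and the comparison of
    values are read off from it. *)
Lemma lower_objectiveD (R : realType) m n (A : 'M[R]_(m, n)) (M : 'M[R]_n)
    x0 y x v (t : R) : M^T = M ->
  lower_objective A M x0 y (x + t *: v) =
  lower_objective A M x0 y x + (2 * t * inner (lower_grad A M x0 y x) v +
    t ^+ 2 * inner ((A^T *m A + M) *m v) v).
Proof.
move=> Mt; rewrite /lower_objective !norm2_sq.
have -> : A *m (x + t *: v) - y = (A *m x - y) + t *: (A *m v).
  by rewrite mulmxDr -scalemxAr addrAC.
have -> : x + t *: v - x0 = (x - x0) + t *: v by rewrite addrAC.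
have -> : inner (lower_grad A M x0 y x) v =
    inner (A *m x - y) (A *m v) + inner (M *m (x - x0)) v.
  rewrite (innerC _ (A *m v)) (inner_mull A v) (innerC v) -innerDl; congr inner.
  by rewrite /lower_grad !mulmxBr mulmxDl mulmxA opprD addrACA.
have -> : inner ((A^T *m A + M) *m v) v = inner (A *m v) (A *m v) + inner (M *m v) v.
  by rewrite mulmxDl innerDl -mulmxA inner_mull trmxK.
rewrite inner_quadD //; move: (A *m x - y) (A *m v) => a p.
by rewrite innerDl !innerDr !innerZl !innerZr (innerC p a); ring.
Qed.

Lemma is_derive_lower_objective (R : realType) m n (A : 'M[R]_(m, n)) (M : 'M[R]_n)
    x0 y x v : M^T = M ->
  is_derive x v (lower_objective A M x0 y) (2 * inner (lower_grad A M x0 y x) v).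
Proof.
move=> Mt; set f := lower_objective A M x0 y.
suff cf : (fun h : R => h^-1 *: ((f \o shift x) (h *: v) - f x)) @ 0^' -->
    2 * inner (lower_grad A M x0 y x) v.
  by split; [apply/cvg_ex; eexists; exact: cf | exact: cvg_lim cf].
set b := inner _ _; set q := inner ((A^T *m A + M) *m v) v.
have c0 : (fun h : R => 2 * b + h * q) @ 0^' --> 2 * b.
  rewrite -[X in _ --> X]addr0 -[X in _ + X](mul0r q).
  apply: cvgD; first exact: cvg_cst.
  apply: cvgM; last exact: cvg_cst.
  exact: (@cvg_within _ _ _).
apply: cvg_trans c0; apply: near_eq_cvg.
near=> h; rewrite /= [h *: v + x]addrC /f lower_objectiveD // -/b -/q.
have h0 : h != 0 by near: h; exact: nbhs_dnbhs_neq.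
by rewrite [X in _ *: X]addrAC subrr add0r /GRing.scale /=; field.
Unshelve. all: by end_near. Qed.

Lemma criticalE (R : realType) m n (A : 'M[R]_(m, n)) (M : 'M[R]_n) x0 y x :
  M^T = M ->
  critical (lower_objective A M x0 y) x <-> lower_grad A M x0 y x = 0.
Proof.
move=> Mt; have der v := is_derive_lower_objective A x0 y x v Mt.
split=> [cx|gx v].
  have /eqP := @derive_val _ _ _ _ _ _ _ (cx (lower_grad A M x0 y x)).
  rewrite (@derive_val _ _ _ _ _ _ _ (der _)) mulf_eq0 pnatr_eq0 /= inner_eq0.
  by move/eqP.
by have := der v; rewrite gx inner0l mulr0.
Qed.

(** The solution of the normal equations (A^T A + M) x = A^T y + M x0, written
    as a correction of x0 so that M only enters through the inverse. *)
Definition recon (R : realType) m n (A : 'M[R]_(m, n)) (M : 'M[R]_n)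
    (x0 : 'cV[R]_n) (y : 'cV[R]_m) : 'cV[R]_n :=
  x0 + invmx (A^T *m A + M) *m A^T *m (y - A *m x0).

Lemma lower_grad_eq0 (R : realType) m n (A : 'M[R]_(m, n)) (M : 'M[R]_n) x0 y x :
  A^T *m A + M \in unitmx ->
  lower_grad A M x0 y x = 0 <->
  x = recon A M x0 y.
Proof.
set K := _ + M => uK; rewrite /lower_grad /recon -/K.
have e : A^T *m y + M *m x0 = K *m x0 + A^T *m (y - A *m x0).
  by rewrite /K mulmxDl mulmxBr mulmxA [RHS]addrC addrA subrK.
rewrite e; split => [/eqP|->].
  rewrite subr_eq0 => /eqP Kx.
  have -> : x = invmx K *m (K *m x) by rewrite mulmxA mulVmx // mul1mx.
  by rewrite Kx mulmxDr !mulmxA mulVmx // mul1mx.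
by rewrite mulmxDr !mulmxA mulmxV // mul1mx subrr.
Qed.

(** A kernel vector of A^T A + M translates critical points to critical
    points, so uniqueness forces invertibility. *)
Lemma critical_singleton (R : realType) m n (A : 'M[R]_(m, n)) (M : 'M[R]_n) x0 y x :
  M^T = M ->
  critical (lower_objective A M x0 y) = [set x] <->
  A^T *m A + M \in unitmx /\ x = recon A M x0 y.
Proof.
move=> Mt; split=> [cx|[uK xE]].
  have /criticalE -/(_ Mt) gx : critical (lower_objective A M x0 y) x.
    by rewrite cx.
  have uK : A^T *m A + M \in unitmx.
    apply: unitmx_ker0 => v Kv.
    have : critical (lower_objective A M x0 y) (x + v).
      by apply/criticalE => //; rewrite /lower_grad mulmxDr Kv addr0.
    by rewrite cx /= => /eqP; rewrite -subr_eq0 addrC addKr => /eqP.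
  by split => //; apply/lower_grad_eq0.
apply/seteqP; split=> z /=.
  by move/(criticalE A x0 y z Mt)/lower_grad_eq0 => ->.
by move=> ->; apply/criticalE => //; apply/lower_grad_eq0.
Qed.

(** At a minimizer the linear term of the expansion vanishes; if the quadratic
    form were not positive at some v, then x + v would minimize as well. *)
Lemma argmin_singleton (R : realType) m n (A : 'M[R]_(m, n)) (M : 'M[R]_n) x0 y x :
  M^T = M ->
  argmin (lower_objective A M x0 y) = [set x] <->
  posdefmx (A^T *m A + M) /\ x = recon A M x0 y.
Proof.
move=> Mt; split=> [cx|[pK xE]].
  have mx : argmin (lower_objective A M x0 y) x by rewrite cx.
  have g0 v : inner (lower_grad A M x0 y x) v = 0.
    apply: (@linear_term0 _ _ (inner ((A^T *m A + M) *m v) v)) => t.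
    by have := mx (x + t *: v); rewrite lower_objectiveD // lerDl.
  have gx : lower_grad A M x0 y x = 0 by apply/eqP; rewrite -inner_eq0 g0.
  have pK : posdefmx (A^T *m A + M).
    move=> v; apply: contra_neqT; rewrite -leNgt => Kv.
    have : argmin (lower_objective A M x0 y) (x + 1 *: v).
      move=> z; apply: le_trans (mx z); rewrite lower_objectiveD // g0.
      by rewrite mulr0 add0r expr1n mul1r gerDl.
    by rewrite cx /= scale1r => /eqP; rewrite -subr_eq0 addrC addKr => /eqP.
  by split => //; apply/lower_grad_eq0 => //; exact: posdef_unit.
have gx : lower_grad A M x0 y x = 0.
  by apply/lower_grad_eq0 => //; exact: posdef_unit.
have fE z : lower_objective A M x0 y z =
    lower_objective A M x0 y x + inner ((A^T *m A + M) *m (z - x)) (z - x).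
  rewrite -{1}(subrK x z) addrC -[z - x]scale1r lower_objectiveD // gx inner0l.
  by rewrite mulr0 add0r expr1n mul1r scale1r.
apply/seteqP; split=> z /=.
  move=> /(_ x); rewrite fE gerDl leNgt => h.
  by apply/eqP; rewrite -subr_eq0; apply: contraNT h => /pK.
by move=> -> w; rewrite (fE w) lerDl; exact: posdef_psd.
Qed.

(** * Second moments of random vectors *)

Lemma fine_expectation_cst d (T : measurableType d) (R : realType)
    (P : probability T R) (r : R) : fine 'E_P[fun=> r] = r.
Proof. by rewrite (expectation_cst P r). Qed.

Lemma fine_expectationD d (T : measurableType d) (R : realType)
    (P : probability T R) (f g : T -> R) :
  f \in Lfun P 1 -> g \in Lfun P 1 ->
  fine 'E_P[fun w => f w + g w] = fine 'E_P[f] + fine 'E_P[g].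
Proof.
by move=> f1 g1; rewrite -fineD ?expectation_fin_num // -expectationD.
Qed.

Lemma fine_expectationZ d (T : measurableType d) (R : realType)
    (P : probability T R) (f : T -> R) a :
  f \in Lfun P 1 -> fine 'E_P[fun w => a * f w] = a * fine 'E_P[f].
Proof.
move=> f1; transitivity (fine (a%:E * 'E_P[f])%E).
  rewrite -expectationZl //; congr (fine 'E_P[_]); apply/funext => w.
  by rewrite /= mulrC.
by rewrite fineM // expectation_fin_num.
Qed.

Lemma Lfun_sumZ d (T : measurableType d) (R : realType)
    (P : probability T R) p (I : finType) (c : I -> R) (F : I -> T -> R) :
  (1 <= p)%E -> (forall i, F i \in Lfun P p) ->
  (fun w => \sum_i c i * F i w) \in Lfun P p.
Proof.
move=> p1 FL; have [L0 LZ] := Lfun_submod_closed P p1.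
have -> : (fun w => \sum_i c i * F i w) = \sum_i c i *: F i.
  by apply/funext => w; rewrite fct_sumE.
elim/big_ind : _ => [//|f g fL gL|i _].
  by have := LZ 1 f g fL gL; rewrite scale1r.
by have := LZ (c i) _ _ (FL i) L0; rewrite addr0.
Qed.

Lemma fine_expectation_sumZ d (T : measurableType d) (R : realType)
    (P : probability T R) (I : finType) (c : I -> R) (F : I -> T -> R) :
  (forall i, F i \in Lfun P 1) ->
  fine 'E_P[fun w => \sum_i c i * F i w] = \sum_i c i * fine 'E_P[F i].
Proof.
move=> FL.
have L1 i : (fun w => c i * F i w) \in Lfun P 1.
  have := Lfun_sumZ (fun _ : 'I_1 => c i) (lexx 1%E) (fun=> FL i).
  by under eq_fun do rewrite big_ord1.
have LS (s : seq I) : (fun w => \sum_(i <- s) c i * F i w) \in Lfun P 1.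
  elim: s => [|i s IHs].
    by under eq_fun do rewrite big_nil; exact: Lfun_cst.
  under eq_fun do rewrite big_cons.
  have [_ LZ] := Lfun_submod_closed P (lexx 1%E).
  by have := LZ 1 _ _ (L1 i) IHs; rewrite scale1r.
elim: (index_enum I) => [|i s IHs].
  by under eq_fun do rewrite big_nil; rewrite fine_expectation_cst big_nil.
under eq_fun do rewrite big_cons.
by rewrite fine_expectationD // fine_expectationZ // IHs big_cons.
Qed.

Definition entrywise_Lfun d (T : measurableType d) (R : realType)
    (P : probability T R) (p : \bar R) k l (X : T -> 'M[R]_(k, l)) : Prop :=
  forall i j, (fun w => X w i j) \in Lfun P p.

Lemma square_integrable_Lfun d (T : measurableType d) (R : realType)
    (P : probability T R) k (X : T -> 'cV[R]_k) :
  square_integrable P X -> entrywise_Lfun P 2%:E X.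
Proof.
move=> [mX fX] i j; rewrite ord1 inE; apply/andP; split.
  by rewrite inE /=; exact: mX.
rewrite inE /= /finite_norm unlock /Lnorm poweR_lty //.
apply: le_lt_trans fX; rewrite /mean_sq unlock; apply: ge0_le_integral => //.
- by move=> w _; rewrite lee_fin powR_ge0.
- apply/measurable_EFinP.
  apply: (measurableT_comp (measurable_powR _)) => //.
  exact: measurableT_comp (mX i).
- apply/measurable_EFinP.
  have -> : (fun w => norm2 (X w) ^+ 2) = (fun w => \sum_l X w l 0 * X w l 0).
    by apply/funext => w; rewrite norm2_sq.
  by apply: measurable_sum => l; exact: measurable_funM.
move=> w _; rewrite /= lee_fin norm2_sq powR_mulrn // real_normK ?num_real //.
rewrite /inner (bigD1 i) //= -expr2 lerDl.
by apply: sumr_ge0 => l _; rewrite -expr2 sqr_ge0.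
Qed.

Lemma entrywise_LfunD d (T : measurableType d) (R : realType)
    (P : probability T R) (p : \bar R) k l (X Y : T -> 'M[R]_(k, l)) :
  (1 <= p)%E -> entrywise_Lfun P p X -> entrywise_Lfun P p Y ->
  entrywise_Lfun P p (fun w => X w + Y w).
Proof.
move=> p1 LX LY i j; have [_ LZ] := Lfun_submod_closed P p1.
under eq_fun do rewrite mxE.
by have := LZ 1 _ _ (LX i j) (LY i j); rewrite scale1r.
Qed.

Lemma entrywise_Lfun_cst d (T : measurableType d) (R : realType)
    (P : probability T R) (r : R) k l (C : 'M[R]_(k, l)) :
  entrywise_Lfun P r%:E (fun=> C).
Proof. by move=> i j; exact: Lfun_cst. Qed.

Lemma entrywise_Lfun_mull d (T : measurableType d) (R : realType)
    (P : probability T R) (p : \bar R) h k l (C : 'M[R]_(h, k))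
    (X : T -> 'M[R]_(k, l)) :
  (1 <= p)%E -> entrywise_Lfun P p X ->
  entrywise_Lfun P p (fun w => C *m X w).
Proof.
move=> p1 LX i j; under eq_fun do rewrite mxE.
by apply: Lfun_sumZ => // ?; exact: LX.
Qed.

Lemma entrywise_Lfun_outer d (T : measurableType d) (R : realType)
    (P : probability T R) k l (X : T -> 'cV[R]_k) (Y : T -> 'cV[R]_l) :
  entrywise_Lfun P 2%:E X -> entrywise_Lfun P 2%:E Y ->
  entrywise_Lfun P 1 (fun w => X w *m (Y w)^T).
Proof.
move=> LX LY i j; under eq_fun do rewrite mxE big_ord1 mxE.
exact: Lfun2_mul_Lfun1 (LX i 0) (LY j 0).
Qed.

Lemma Emx_cst d (T : measurableType d) (R : realType)
    (P : probability T R) k l (C : 'M[R]_(k, l)) : Emx P (fun=> C) = C.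
Proof. by apply/matrixP => i j; rewrite mxE fine_expectation_cst. Qed.

Lemma EmxD d (T : measurableType d) (R : realType)
    (P : probability T R) k l (X Y : T -> 'M[R]_(k, l)) :
  entrywise_Lfun P 1 X -> entrywise_Lfun P 1 Y ->
  Emx P (fun w => X w + Y w) = Emx P X + Emx P Y.
Proof.
move=> LX LY; apply/matrixP => i j; rewrite !mxE -fine_expectationD //.
by under eq_fun do rewrite mxE.
Qed.

Lemma Emx_mull d (T : measurableType d) (R : realType)
    (P : probability T R) h k l (C : 'M[R]_(h, k)) (X : T -> 'M[R]_(k, l)) :
  entrywise_Lfun P 1 X -> Emx P (fun w => C *m X w) = C *m Emx P X.
Proof.
move=> LX; apply/matrixP => i j; rewrite !mxE.
under eq_fun do rewrite mxE.
rewrite fine_expectation_sumZ; last by move=> ?; exact: LX.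
by apply: eq_bigr => a _; rewrite mxE.
Qed.

Lemma Emx_tr d (T : measurableType d) (R : realType)
    (P : probability T R) k l (X : T -> 'M[R]_(k, l)) :
  Emx P (fun w => (X w)^T) = (Emx P X)^T.
Proof.
by apply/matrixP => i j; rewrite !mxE; under eq_fun do rewrite mxE.
Qed.

Lemma Emx_mulr d (T : measurableType d) (R : realType)
    (P : probability T R) h k l (C : 'M[R]_(l, h)) (X : T -> 'M[R]_(k, l)) :
  entrywise_Lfun P 1 X -> Emx P (fun w => X w *m C) = Emx P X *m C.
Proof.
move=> LX; apply: trmx_inj; rewrite -Emx_tr.
under eq_fun do rewrite trmx_mul.
rewrite Emx_mull ?Emx_tr ?trmx_mul // => i j.
by under eq_fun do rewrite mxE; exact: LX.
Qed.

Definition second_moment d (T : measurableType d) (R : realType)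
    (P : probability T R) k (X : T -> 'cV[R]_k) : 'M[R]_k :=
  Emx P (fun w => X w *m (X w)^T).

Lemma mean_sq_second_moment d (T : measurableType d) (R : realType)
    (P : probability T R) k (X : T -> 'cV[R]_k) :
  entrywise_Lfun P 2%:E X ->
  mean_sq P X = (\tr (second_moment P X))%:E.
Proof.
move=> LX; have L1 i : (fun w => X w i 0 * X w i 0) \in Lfun P 1.
  exact: Lfun2_mul_Lfun1.
have sqE : (fun w => norm2 (X w) ^+ 2) =
    (fun w => \sum_i 1 * (X w i 0 * X w i 0)).
  by apply/funext => w; rewrite norm2_sq; apply: eq_bigr => i _; rewrite mul1r.
rewrite /mean_sq sqE -[LHS]fineK; last first.
  by apply: expectation_fin_num; exact: Lfun_sumZ.
rewrite fine_expectation_sumZ //; congr (_%:E).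
apply: eq_bigr => i _; rewrite mul1r mxE.
by under [in RHS]eq_fun do rewrite mxE big_ord1 mxE.
Qed.

(** Orthogonality is expressed by the uncentered cross moment, which covers both
    uncorrelated centered vectors and a centered vector plus a constant. *)
Lemma second_momentD d (T : measurableType d) (R : realType)
    (P : probability T R) k (X Y : T -> 'cV[R]_k) :
  entrywise_Lfun P 2%:E X -> entrywise_Lfun P 2%:E Y ->
  Emx P (fun w => X w *m (Y w)^T) = 0 ->
  second_moment P (fun w => X w + Y w) = second_moment P X + second_moment P Y.
Proof.
move=> LX LY XY; rewrite /second_moment.
under eq_fun do rewrite linearD /= mulmxDl !mulmxDr.
have := (entrywise_Lfun_outer LX LX, entrywise_Lfun_outer LX LY,
  entrywise_Lfun_outer LY LX, entrywise_Lfun_outer LY LY) => -[[[XX XY1] YX] YY].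
rewrite EmxD; do ?exact: entrywise_LfunD.
rewrite !EmxD // XY addr0.
suff -> : Emx P (fun w => Y w *m (X w)^T) = 0 by rewrite add0r.
have -> : (fun w => Y w *m (X w)^T) = (fun w => (X w *m (Y w)^T)^T).
  by apply/funext => w; rewrite trmx_mul trmxK.
by rewrite Emx_tr XY trmx0.
Qed.

Lemma second_moment_mull d (T : measurableType d) (R : realType)
    (P : probability T R) k l (U : 'M[R]_(l, k)) (X : T -> 'cV[R]_k) :
  entrywise_Lfun P 2%:E X ->
  second_moment P (fun w => U *m X w) = U *m second_moment P X *m U^T.
Proof.
move=> LX; rewrite /second_moment.
under eq_fun do rewrite trmx_mul mulmxA -(mulmxA U).
have LXX := entrywise_Lfun_outer LX LX.
by rewrite Emx_mulr ?Emx_mull //; exact: entrywise_Lfun_mull.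
Qed.

Lemma second_moment_affine d (T : measurableType d) (R : realType)
    (P : probability T R) h k l (U : 'M[R]_(h, k)) (V : 'M[R]_(h, l)) c
    (X : T -> 'cV[R]_k) (Y : T -> 'cV[R]_l) :
  entrywise_Lfun P 2%:E X -> entrywise_Lfun P 2%:E Y ->
  Emx P X = 0 -> Emx P Y = 0 -> Emx P (fun w => X w *m (Y w)^T) = 0 ->
  second_moment P (fun w => U *m X w + V *m Y w + c) =
  U *m second_moment P X *m U^T + V *m second_moment P Y *m V^T + c *m c^T.
Proof.
move=> LX LY X0 Y0 XY; have p12 : (1 <= 2%:E :> \bar R)%E by rewrite lee_fin ler1n.
have L21 := Lfun_subset12 (fin_num_measure P _ measurableT).
have LUX := entrywise_Lfun_mull U p12 LX; have LVY := entrywise_Lfun_mull V p12 LY.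
have LS := entrywise_LfunD p12 LUX LVY.
have L1S : entrywise_Lfun P 1 (fun w => U *m X w + V *m Y w).
  by move=> i j; apply: L21; exact: LS.
rewrite second_momentD //.
- rewrite second_momentD //; last first.
    under eq_fun do rewrite trmx_mul mulmxA -(mulmxA U).
    have LXY := entrywise_Lfun_outer LX LY.
    rewrite Emx_mulr ?Emx_mull // ?XY ?mulmx0 ?mul0mx //.
    exact: entrywise_Lfun_mull.
  by rewrite !second_moment_mull // /second_moment Emx_cst.
- exact: entrywise_Lfun_cst.
- have L1X : entrywise_Lfun P 1 X by move=> i j; apply: L21; exact: LX.
  have L1Y : entrywise_Lfun P 1 Y by move=> i j; apply: L21; exact: LY.
  rewrite Emx_mulr // EmxD; do ?exact: entrywise_Lfun_mull.
  by rewrite !Emx_mull // X0 Y0 !mulmx0 addr0 mul0mx.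
Qed.

Lemma tr_second_moment_ge0 d (T : measurableType d) (R : realType)
    (P : probability T R) k (X : T -> 'cV[R]_k) :
  entrywise_Lfun P 2%:E X -> 0 <= \tr (second_moment P X).
Proof.
move=> LX; rewrite -lee_fin -mean_sq_second_moment //.
by apply: expectation_ge0 => w; rewrite sqr_ge0.
Qed.

(** v^T E(X X^T) v is the second moment of the scalar v^T X. *)
Lemma second_moment_psd d (T : measurableType d) (R : realType)
    (P : probability T R) k (X : T -> 'cV[R]_k) :
  entrywise_Lfun P 2%:E X -> psdmx (second_moment P X).
Proof.
move=> LX v; have p12 : (1 <= 2%:E :> \bar R)%E by rewrite lee_fin ler1n.
have := tr_second_moment_ge0 (entrywise_Lfun_mull v^T p12 LX).
by rewrite second_moment_mull // trmxK -mulmxA innerC innerE.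
Qed.

Lemma second_moment_tr d (T : measurableType d) (R : realType)
    (P : probability T R) k (X : T -> 'cV[R]_k) :
  (second_moment P X)^T = second_moment P X.
Proof.
by rewrite -Emx_tr; under eq_fun do rewrite trmx_mul trmxK.
Qed.

(** * The risk as a function of the parameters *)

(** The left side is tr (W B W) - tr (W (G Sx + Sx G)) + tr Sx with
    G = A^T A; the Lyapunov equation turns its linear part into
    tr (W N B) + tr (W B N), the cross terms of the square. *)
Lemma tr_completion_square (R : realType) m n (A : 'M[R]_(m, n)) (Sx : 'M[R]_n)
    (Se : 'M[R]_m) (B N W : 'M[R]_n) :
  W^T = W -> N^T = N ->
  B = A^T *m (A *m Sx *m A^T + Se) *m A -> lyapunov A Sx B N ->
  \tr ((W *m (A^T *m A) - 1%:M) *m Sx *m (W *m (A^T *m A) - 1%:M)^T) +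
    \tr (W *m A^T *m Se *m (W *m A^T)^T) =
  \tr Sx - \tr (N *m B *m N) + \tr ((W - N)^T *m B *m (W - N)).
Proof.
move=> Wt Nt BE; rewrite /lyapunov => /(congr1 (fun X => \tr (W *m X))).
have WBW : \tr (W *m B *m W) =
    \tr (W *m (A^T *m A) *m Sx *m (W *m (A^T *m A))^T) +
    \tr (W *m A^T *m Se *m (W *m A^T)^T).
  rewrite BE mulmxDr mulmxDl mulmxDr mulmxDl mxtraceD !trmx_mul !trmxK Wt.
  by rewrite !mulmxA.
rewrite ![(_ - _)^T]linearB /= trmx1 Wt Nt.
rewrite !(mulmxBl, mulmxBr) !mulmx1 !mul1mx !mulmxDr !mxtraceD !raddfN /=.
rewrite !mxtraceD !raddfN /= => e.
have e1 : \tr (Sx *m (W *m (A^T *m A))^T) = \tr (W *m (Sx *m A^T *m A)).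
  by rewrite [RHS]mxtrace_mulC !trmx_mul trmxK Wt !mulmxA.
have e2 : \tr (W *m (A^T *m A) *m Sx) = \tr (W *m (A^T *m A *m Sx)).
  by rewrite !mulmxA.
have e3 : \tr (W *m (N *m B)) = \tr (N *m B *m W) by rewrite mxtrace_mulC.
have e4 : \tr (W *m (B *m N)) = \tr (W *m B *m N) by rewrite mulmxA.
rewrite e1 e2; move: e; rewrite e3 e4 WBW; lra.
Qed.

(** The bias is (1 - W A^T A) (x0 - mu), and 1 = W (A^T A + M) makes it
    W M (x0 - mu): this is where ker M enters. *)
Lemma recon_error (R : realType) m n (A : 'M[R]_(m, n)) (M : 'M[R]_n)
    (x0 mu x : 'cV[R]_n) (e : 'cV[R]_m) (W := invmx (A^T *m A + M)) :
  A^T *m A + M \in unitmx ->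
  recon A M x0 (A *m x + e) - x =
  (W *m (A^T *m A) - 1%:M) *m (x - mu) + W *m A^T *m e + W *m (M *m (x0 - mu)).
Proof.
move=> uK; have -> : W *m (M *m (x0 - mu)) = (1%:M - W *m (A^T *m A)) *m (x0 - mu).
  have <- : W *m M = 1%:M - W *m (A^T *m A).
    by rewrite -(mulVmx uK) -/W mulmxDr addrAC subrr add0r.
  by rewrite mulmxA.
have -> : recon A M x0 (A *m x + e) =
    x0 + (W *m A^T *m e + W *m (A^T *m A) *m (x - x0)).
  have e1 : A *m x + e - A *m x0 = e + A *m (x - x0).
    by rewrite mulmxBr addrAC addrC.
  by rewrite /recon -/W e1 mulmxDr !mulmxA.
rewrite !mulmxBl !mul1mx !mulmxBr.
set a := W *m A^T *m e; set g := W *m (A^T *m A) *m x.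
set g0 := _ *m x0; set g1 := _ *m mu.
by apply/colP => i; rewrite !mxE; ring.
Qed.

(** In the error formula, xdag - mu and eps are centered and uncorrelated and the
    bias is constant, so no cross terms survive; the square is then completed. *)
Lemma upper_objective_recon (R : realType) (d : measure_display)
    (T : measurableType d) (P : probability T R) m n (A : 'M[R]_(m, n))
    (xdag : T -> 'cV[R]_n) (eps : T -> 'cV[R]_m) (B N M : 'M[R]_n) x0
    (W := invmx (A^T *m A + M)) :
  square_integrable P xdag -> square_integrable P eps ->
  uncorrelated P xdag eps -> Emx P eps = 0 ->
  B = A^T *m (A *m cov P xdag *m A^T + cov P eps) *m A ->
  N^T = N -> lyapunov A (cov P xdag) B N ->
  M^T = M -> A^T *m A + M \in unitmx ->
  upper_objective P xdag (fun w => recon A M x0 (A *m xdag w + eps w)) =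
  (\tr (cov P xdag) - \tr (N *m B *m N) +
   (\tr ((W - N)^T *m B *m (W - N)) +
    inner (W *m (M *m (x0 - Emx P xdag))) (W *m (M *m (x0 - Emx P xdag)))))%:E.
Proof.
move=> /square_integrable_Lfun LX /square_integrable_Lfun LE XE E0 BE Nt lN Mt uK.
set mu := Emx P xdag; set c := W *m _; pose Z w := xdag w - mu.
have p12 : (1 <= 2%:E :> \bar R)%E by rewrite lee_fin ler1n.
have L21 := Lfun_subset12 (fin_num_measure P _ measurableT).
have LZ : entrywise_Lfun P 2%:E Z.
  by apply: entrywise_LfunD => //; exact: entrywise_Lfun_cst.
have Z0 : Emx P Z = 0.
  rewrite EmxD ?Emx_cst ?subrr //; last exact: entrywise_Lfun_cst.
  by move=> i j; apply: L21; exact: LX.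
have ZE : Emx P (fun w => Z w *m (eps w)^T) = 0.
  by rewrite -[RHS]XE /cross_cov E0; under [in RHS]eq_fun do rewrite subr0.
have covE : cov P eps = second_moment P eps.
  by rewrite /cov /cross_cov E0; under eq_fun do rewrite subr0.
have covX : cov P xdag = second_moment P Z by [].
have errE : (fun w => recon A M x0 (A *m xdag w + eps w) - xdag w) =
    (fun w => (W *m (A^T *m A) - 1%:M) *m Z w + W *m A^T *m eps w + c).
  by apply/funext => w; rewrite (recon_error x0 mu).
have Wt : W^T = W by rewrite trmx_inv linearD /= trmx_mul trmxK Mt.
rewrite /upper_objective errE mean_sq_second_moment; last first.
  do 2 ?apply: entrywise_LfunD => //; try exact: entrywise_Lfun_mull.
  exact: entrywise_Lfun_cst.
rewrite second_moment_affine // !mxtraceD.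
rewrite [\tr (c *m _)]mxtrace_mulC -innerE addrA -covE -covX.
by rewrite (tr_completion_square Wt Nt BE lN).
Qed.

(** v^T B v is the sum of the forms of the two second moments at A^T A v and
    at A v. *)
Lemma lyapunov_matrix_posdef (R : realType) (d : measure_display)
    (T : measurableType d) (P : probability T R) m n (A : 'M[R]_(m, n))
    (X : T -> 'cV[R]_n) (E : T -> 'cV[R]_m)
    (B := A^T *m (A *m second_moment P X *m A^T + second_moment P E) *m A) :
  entrywise_Lfun P 2%:E X -> entrywise_Lfun P 2%:E E ->
  B \in unitmx -> B^T = B /\ posdefmx B.
Proof.
move=> LX LE uB.
have Bt : B^T = B.
  rewrite /B !trmx_mul trmxK linearD /= !trmx_mul trmxK !second_moment_tr.
  by rewrite !mulmxA.
split=> //; apply: psd_unit_posdef => // v.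
rewrite /B -!mulmxA inner_mull trmxK mulmxDl innerDl.
rewrite -!mulmxA inner_mull addr_ge0 //; exact: second_moment_psd.
Qed.

(** * The bilevel problem *)

(** Here [adm] is the condition on A^T A + M under which the lower-level problem
    is uniquely solvable: invertibility for critical points, positive
    definiteness for minimizers.  The hypothesis giving t provides a competitor
    whose inverse matrix lies on the segment from
    W = (A^T A + M)^-1 to N, with square term
    (1 - t)^2 times that of W and, by the choice x0 = mu, no bias. *)
Lemma bilevel_solution_admissible (R : realType) (d : measure_display)
    (T : measurableType d) (P : probability T R) m n (A : 'M[R]_(m, n))
    (xdag : T -> 'cV[R]_n) (eps : T -> 'cV[R]_m) (B N : 'M[R]_n)
    (sol : ('cV[R]_n -> R) -> set 'cV[R]_n) (adm : 'M[R]_n -> Prop) :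
  square_integrable P xdag -> square_integrable P eps ->
  uncorrelated P xdag eps -> Emx P eps = 0 ->
  B = A^T *m (A *m cov P xdag *m A^T + cov P eps) *m A -> posdefmx B ->
  N^T = N -> lyapunov A (cov P xdag) B N ->
  (forall M x0 y x, M^T = M ->
    sol (lower_objective A M x0 y) = [set x] <->
    adm (A^T *m A + M) /\ x = recon A M x0 y) ->
  (forall K, adm K -> K \in unitmx) ->
  (forall K, K^T = K -> adm K -> exists t : R,
    [/\ 0 < t, t <= 1 & adm (invmx (invmx K + t *: (N - invmx K)))]) ->
  forall M x0,
    bilevel_solution A P xdag eps sol M x0 <->
    adm (invmx N) /\
    (exists2 k : 'cV[R]_n, M *m k = 0 & x0 = Emx P xdag + k) /\
    M = invmx N - A^T *m A.
Proof.
move=> X2 E2 XE E0 BE pB Nt lN solE adm_unit adm_star M x0.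
set G := A^T *m A; set mu := Emx P xdag.
have Gt : G^T = G by rewrite trmx_mul trmxK.
(* The lower-level condition is pointwise in w, so some w is needed to read
   off admissibility. *)
have [w0 _] : [set: T] !=set0.
  apply/set0P; apply: contraTneq (oner_neq0 R) => T0.
  have := probability_setT P; rewrite T0 measure0 => /eqP.
  by rewrite eqe eq_sym => /eqP ->; rewrite eqxx.
have reconE M' x0' xhat : M'^T = M' -> reconstruction A xdag eps sol M' x0' xhat <->
    adm (G + M') /\ xhat = fun w => recon A M' x0' (A *m xdag w + eps w).
  move=> Mt'; split=> [rec|[aK ->] w]; last by apply/solE.
  by split; [have /solE[] := rec w0|apply/funext => w; have /solE[] := rec w].
(* the part of the risk that depends on the parameters *)
pose excess M' x0' := let W := invmx (G + M') in
  \tr ((W - N)^T *m B *m (W - N)) +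
  inner (W *m (M' *m (x0' - mu))) (W *m (M' *m (x0' - mu))).
have excess_ge0 M' x0' : 0 <= excess M' x0'.
  by rewrite addr_ge0 ?inner_ge0 // tr_quad_ge0 //; exact: posdef_psd.
have riskE M' x0' : M'^T = M' -> adm (G + M') ->
    upper_objective P xdag (fun w => recon A M' x0' (A *m xdag w + eps w)) =
    (\tr (cov P xdag) - \tr (N *m B *m N) + excess M' x0')%:E.
  by move=> Mt' /adm_unit uK; exact: upper_objective_recon.
have bilevelE : bilevel_solution A P xdag eps sol M x0 <->
    [/\ M^T = M, adm (G + M) & forall M' x0', M'^T = M' -> adm (G + M') ->
      excess M x0 <= excess M' x0'].
  split=> [[Mt [xhat /(reconE _ _ _ Mt)[aK xhatE] opt]]|[Mt aK opt]].
    split=> // M' x0' Mt' aK'.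
    have /opt := (reconE M' x0' _ Mt').2 (conj aK' erefl).
    by rewrite xhatE !riskE // lee_fin lerD2l; exact.
  split=> //; exists (fun w => recon A M x0 (A *m xdag w + eps w)).
    exact/reconE.
  move=> M' x0' xhat' Mt' /(reconE _ _ _ Mt')[aK' ->].
  by rewrite !riskE // lee_fin lerD2l opt.
have NVt : (invmx N)^T = invmx N by rewrite trmx_inv Nt.
split=> [/bilevelE[Mt aK opt]|[aN [[k Mk x0E] ME]]]; last first.
  apply/bilevelE; split; first by rewrite ME linearB /= NVt Gt.
    by rewrite ME addrC subrK.
  move=> M' x0' _ _; apply: le_trans (excess_ge0 _ _).
  rewrite /excess x0E [mu + k]addrC addrK Mk mulmx0 inner0l ME.
  by rewrite [G + _]addrC subrK invmxK subrr mulmx0 mxtrace0 addr0.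
have uK := adm_unit _ aK.
set W := invmx (G + M) in uK *.
have Wt : W^T = W by rewrite trmx_inv linearD /= Gt Mt.
have uW : W \in unitmx by rewrite unitmx_inv.
have [t [t0 t1 aKt]] : exists t : R,
    [/\ 0 < t, t <= 1 & adm (invmx (W + t *: (N - W)))].
  by apply: adm_star => //; rewrite linearD /= Gt Mt.
set tau := \tr ((W - N)^T *m B *m (W - N)).
set c := W *m (M *m (x0 - mu)).
have tau0 : 0 <= tau by apply: tr_quad_ge0; exact: posdef_psd.
have : tau + inner c c <= (1 - t) ^+ 2 * tau.
  have := opt (invmx (W + t *: (N - W)) - G) mu.
  rewrite [G + _]addrC subrK linearB /= trmx_inv linearD linearZ linearB /= Wt Nt Gt.
  move=> /(_ erefl aKt) /le_trans; apply.
  rewrite /excess [G + _]addrC subrK invmxK subrr !mulmx0 inner0l addr0.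
  have -> : W + t *: (N - W) - N = (1 - t) *: (W - N).
    by apply/matrixP => i j; rewrite !mxE; ring.
  by rewrite [(_ *: _)^T]linearZ /= -!scalemxAl -scalemxAr !mxtraceZ mulrA -expr2.
move=> le_tau; have c0 := inner_ge0 c.
have : (1 - t) ^+ 2 * tau <= (1 - t) * tau by rewrite ler_wpM2r //; nra.
move=> /(le_trans le_tau) {}le_tau.
have ttau0 : 0 <= t * tau by rewrite mulr_ge0 // ltW.
have /eqP : inner c c = 0 by lra.
have tauE : tau = 0.
  have /eqP : t * tau = 0 by lra.
  by rewrite mulf_eq0 gt_eqF //= => /eqP.
rewrite inner_eq0 => /eqP cE.
have WN : W = N.
  by apply/eqP; rewrite -subr_eq0; apply/eqP; exact: tr_quad_eq0 tauE.
have KE : G + M = invmx N by rewrite -WN invmxK.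
split; first by rewrite -KE.
split; last by rewrite -KE addrC addKr.
exists (x0 - mu); last by rewrite addrC subrK.
by rewrite -[LHS]mul1mx -(mulVmx uW) -mulmxA -/c cE mulmx0.
Qed.

Theorem theorem5p3 (R : realType) (d : measure_display) (T : measurableType d)
    (P : probability T R) (m n : nat) (A : 'M[R]_(m, n))
    (xdag : T -> 'cV[R]_n) (eps : T -> 'cV[R]_m)
    (mu : 'cV[R]_n) (Sx : 'M[R]_n) (Se : 'M[R]_m)
    (xdag_L2 : square_integrable P xdag) (eps_L2 : square_integrable P eps)
    (xdag_eps : uncorrelated P xdag eps)
    (xdag_mean : Emx P xdag = mu) (xdag_cov : cov P xdag = Sx)
    (eps_mean : Emx P eps = 0) (eps_cov : cov P eps = Se)
    (B : 'M[R]_n) (B_def : B = A^T *m (A *m Sx *m A^T + Se) *m A)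
    (B_inv : B \in unitmx) :
  (exists! N : 'M[R]_n, N^T = N /\ lyapunov A Sx B N) /\
  forall N : 'M[R]_n, N^T = N -> lyapunov A Sx B N -> N \in unitmx ->
    (forall (M : 'M[R]_n) (x0 : 'cV[R]_n),
       bilevel_solution A P xdag eps (@argmin R n) M x0 <->
       posdefmx N /\
       (exists2 k : 'cV[R]_n, M *m k = 0 & x0 = mu + k) /\
       M = invmx N - A^T *m A) /\
    (forall (M : 'M[R]_n) (x0 : 'cV[R]_n),
       bilevel_solution A P xdag eps (@critical R n) M x0 <->
       (exists2 k : 'cV[R]_n, M *m k = 0 & x0 = mu + k) /\
       M = invmx N - A^T *m A).
Proof.
subst mu Sx Se.
have centered k (X : T -> 'cV[R]_k) : square_integrable P X ->
    entrywise_Lfun P 2%:E (fun w => X w - Emx P X).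
  move=> /square_integrable_Lfun LX; apply: entrywise_LfunD => //.
    by rewrite lee_fin ler1n.
  exact: entrywise_Lfun_cst.
have [Bt pB] : B^T = B /\ posdefmx B.
  subst B; exact: lyapunov_matrix_posdef
    (centered _ _ xdag_L2) (centered _ _ eps_L2) B_inv.
split.
  by apply: lyapunov_exists_unique => //; exact: second_moment_tr.
move=> N Nt lN uN; split=> M x0.
  have h := bilevel_solution_admissible xdag_L2 eps_L2 xdag_eps eps_mean B_def pB
    Nt lN (@argmin_singleton R m n A) (@posdef_unit R n).
  have pNV : posdefmx (invmx N) <-> posdefmx N.
    split; last exact: posdef_inv.
    by move=> /posdef_inv; rewrite invmxK trmx_inv Nt; exact.
  rewrite -pNV; apply: h => K Kt pK.
  have KVt : (invmx K)^T = invmx K by rewrite trmx_inv Kt.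
  have [t [t0 t1 pt]] := posdef_perturb (N - invmx K) KVt (posdef_inv Kt pK).
  exists t; split=> //; apply: posdef_inv => //.
  by rewrite linearD linearZ linearB /= KVt Nt.
have h := bilevel_solution_admissible xdag_L2 eps_L2 xdag_eps eps_mean B_def pB
  Nt lN (@critical_singleton R m n A) (fun _ => id).
have uNV : invmx N \in unitmx by rewrite unitmx_inv.
(* any invertible matrix is admissible, so one can jump to N at once: t = 1 *)
have {}h := h _ M x0; rewrite h; first by split=> [[]|].
move=> K Kt uK; exists 1; split=> //.
by rewrite scale1r addrC subrK.
Qed.
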